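(* Let $p\ge 1$ be a fixed positive integer. For each integer $N\ge 1$, let $T_{N(1)},\dots,T_{N(p)}$ be independent random variables, each distributed as the number of trials needed to detect all $N$ types at least once in the coupon collector's problem with $N$ equally likely types, and let $M_{N(p)}:=\min_{1\le i\le p}T_{N(i)}$. Then for every $N\geq 1$ $$E\left[M_{N(p)}\right]=\sum_{k=0}^{\infty}\left(1-S(k,N)\frac{N!}{N^{k}}\right)^{p},$$ where $S(k,N)$ are the Stirling numbers of the second kind. Moreover, as $N\rightarrow\infty$ (with $p$ fixed), $$E\left[M_{N(p)}\right]=N\left[\ln N+\left(\gamma+p\,c_{p}\right)+O\left(\frac{(\ln N)^{2}}{N}\right)\right],$$ where $\gamma$ is the Euler--Mascheroni constant and $$c_{p}:=\sum_{j=0}^{p-1}(-1)^{j}\binom{p-1}{j}\frac{\ln(1+j)}{j+1}.$$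
   Context: Coupon collector's problem with uniform probabilities: a collector samples independently with replacement, each trial yielding one of $N$ types, each type with probability $1/N$. The number of trials needed is the index of the first trial at which every one of the $N$ types has been observed at least once. The $p$ collectors sample independently of each other, and $T_{N(i)}$ is this number of trials for the $i$-th collector. $S(k,N)$ is the number of partitions of a set of $k$ labeled objects into $N$ nonempty unlabeled subsets, i.e. $S(k,N)=\frac{1}{N!}\sum_{n=0}^{N}(-1)^{N-n}\binom{N}{n}n^{k}$ (with $0^0=1$); in particular $S(k,N)=0$ for $k<N$. The constant implied by $O(\cdot)$ may depend on $p$. *)

(* Defs.v *)
From HB Require Import structures.
From mathcomp Require Import all_boot all_order all_algebra.
From mathcomp Require Import all_classical all_reals all_analysis.
From mathcomp Require Import measurable_realfun.

Set Implicit Arguments.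
Unset Strict Implicit.
Unset Printing Implicit Defensive.

Import Order.TTheory GRing.Theory Num.Theory.
Import numFieldNormedType.Exports.

Local Open Scope classical_set_scope.
Local Open Scope ring_scope.

(* Qualified because [classical_sets] shadows it; it requires nonempty blocks. *)
Definition stirling2 (k N : nat) : nat :=
  #|[pred B : {set {set 'I_k}} | finset.partition B [set: 'I_k] & #|B| == N]|.

Definition euler_gamma (R : realType) : R :=
  limn (fun n : nat => (\sum_(1 <= k < n.+1) k%:R^-1) - ln n%:R : R).

Definition min_const (R : realType) (p : nat) : R :=
  \sum_(0 <= j < p) (-1) ^+ j * 'C(p.-1, j)%:R * (ln (1 + j%:R) / j.+1%:R).

Section Probability.
Context (d : measure_display) (Omega : measurableType d) (R : realType).
Variable P : probability Omega R.

Definition mutually_independent d' (T : measurableType d') (I : eqType)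
    (X : I -> {RV P >-> T}) : Prop :=
  forall (J : seq I) (A : I -> set T),
    uniq J -> (forall i, measurable (A i)) ->
    P (\bigcap_(i in [set` J]) X i @^-1` A i) =
      (\prod_(i <- J) P (X i @^-1` A i))%E.

(* The [N] types are [0, ..., N.-1], taken in [nat] because ['I_N] carries no
   measurable structure. *)
Definition uniform_draws (N : nat) (X : nat -> {RV P >-> nat}) : Prop :=
  [/\ mutually_independent X,
      forall (n : nat) (w : Omega), (X n w < N)%N &
      forall n j : nat, (j < N)%N -> P (X n @^-1` [set j]) = (N%:R^-1)%:E].

End Probability.

(* The draws [x 0, ..., x k.-1] are the first [k] trials, so the least [k] for
   which they exhibit every type is the index, counted from 1, of the completing
   trial. The value is [+oo] when some type never appears. *)
Definition collection_time (R : realType) (N : nat) (x : nat -> nat) : \bar R :=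
  ereal_inf [set k%:R%:E | k in
    [set k : nat | forall j : nat, (j < N)%N ->
                     exists2 n : nat, (n < k)%N & x n = j]].

(* The reference collector may live on a sample space of its own. *)
Definition coupon_distributed (d : measure_display) (Omega : measurableType d)
    (R : realType) (P : probability Omega R) (N : nat)
    (T : {RV P >-> \bar R}) : Prop :=
  exists (d' : measure_display) (W : measurableType d') (Q : probability W R)
         (X : nat -> {RV Q >-> nat}),
    uniform_draws N X /\
    forall A : set (\bar R), measurable A ->
      distribution P T A = Q [set w | A (collection_time R N (fun n => X n w))].

Definition min_time (d : measure_display) (Omega : measurableType d)
    (R : realType) (P : probability Omega R) (p : nat)
    (T : 'I_p -> {RV P >-> \bar R}) (w : Omega) : \bar R :=
  \big[Order.min/+oo%E]_(i < p) T i w.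

Definition expected_min (d : measure_display) (Omega : measurableType d)
    (R : realType) (P : probability Omega R) (p : nat)
    (T : 'I_p -> {RV P >-> \bar R}) : \bar R :=
  (\int[P]_w min_time T w)%E.

(* Main.v *)
(** Write [F m] for the probability that [m] draws exhibit all [N] types, so that
    the expectation is the sum of [(1 - F m) ^+ p].  Let [x = 1 - 1/N] and
    [G m = (1 - x ^+ m) ^+ N].  The occupancies of the types are negatively
    correlated, hence [F <= G].  The sum of [1 - F] is at most [N H_N], while a
    telescoping estimate (a Riemann sum of [(1 - (1 - y) ^+ n) / y] along
    [y = x ^+ m]) places the sum of [1 - G ^+ k] between [(N - 1) H_(kN)] and
    [N H_(kN)].  As [F <= G], replacing [F] by [G] in the sum of [(1 - F) ^+ p]
    therefore costs at most [p H_N = O(ln N)].  The rest is the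
    binomial expansion of [(1 - G) ^+ p] in the [1 - G ^+ k] together with
    [H_n = ln n + gamma + O(1/n)]. *)
Require Import Defs.
From mathcomp Require Import all_boot all_order all_algebra.
From mathcomp Require Import all_classical all_reals all_analysis.
From mathcomp Require Import measurable_realfun ring lra zify.
Import Order.TTheory GRing.Theory Num.Theory.
Import numFieldNormedType.Exports.
Set Implicit Arguments.
Unset Strict Implicit.
Unset Printing Implicit Defensive.
Local Open Scope classical_set_scope.
Local Open Scope ring_scope.

(* The probability that [n] given types out of [N] all occur in [m] draws,
   conditioned on the type of one draw. *)
Fixpoint cover_prob (R : fieldType) (N n m : nat) : R :=
  if m is m'.+1 then
    n%:R / N%:R * cover_prob R N n.-1 m' +
    (1 - n%:R / N%:R) * cover_prob R N n m'
  else (n == 0%N)%:R.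

Definition harmonic_sum (R : fieldType) (n : nat) : R := \sum_(i < n) i.+1%:R^-1.

(** * Covering probabilities and negative correlation *)

Section CoverProb.
Context {R : realFieldType}.
Implicit Types N n m : nat.

Lemma ratio_itv N n : (0 < N)%N -> (n <= N)%N -> 0 <= (n%:R / N%:R : R) <= 1.
Proof.
move=> N0 nN; rewrite divr_ge0 ?ler0n//= ler_pdivrMr ?ltr0n// mul1r.
by rewrite ler_nat.
Qed.

Lemma cover_prob_itv N n m : (0 < N)%N -> (n <= N)%N ->
  0 <= cover_prob R N n m <= 1.
Proof.
move=> N0; elim: m n => [|m IH] n nN /=.
  by case: (n == 0%N); rewrite /= ?mulr1n ?mulr0n ?ler01 ?lexx.
have /andP[a0 a1] := ratio_itv N0 nN.
have /andP[b0 b1] := IH n nN.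
have /andP[c0 c1] := IH n.-1 (leq_trans (leq_pred n) nN).
apply/andP; split; nra.
Qed.

(** With [a = n.+1 / N], [b = n / N] and [c] the values at [m], the two recurrences differ by [(1 -
    a) (c_n - c_n.+1) + b (c_n.-1 - c_n)], nonnegative by induction. *)
Lemma cover_prob_pred N n m : (0 < N)%N -> (n <= N)%N ->
  cover_prob R N n m <= cover_prob R N n.-1 m.
Proof.
move=> N0; elim: m n => [|m IH] [|n] nN; rewrite ?lexx //=.
have nN' := ltnW nN.
have /andP[a0 a1] := ratio_itv N0 nN; have /andP[b0 b1] := ratio_itv N0 nN'.
have := IH n.+1 nN; have := IH n nN' => /= h1 h2.
nra.
Qed.

Lemma cover_prob_le_types N n m : (0 < N)%N -> (n <= N)%N ->
  cover_prob R N.+1 n m <= cover_prob R N n m.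
Proof.
move=> N0; elim: m n => [|m IH] n nN //=.
have /andP[a0 a1] := ratio_itv N0 nN.
have /andP[b0 b1] := ratio_itv (ltn0Sn N) (leqW nN).
have ba : n%:R / N.+1%:R <= n%:R / N%:R :> R.
  by rewrite ler_wpM2l ?ler0n// lef_pV2 ?posrE ?ltr0n// ler_nat.
have h1 := IH n nN; have h2 := IH n.-1 (leq_trans (leq_pred n) nN).
have h3 := cover_prob_pred m N0 nN.
(* The middle term has the weights of [N.+1] and the probabilities of [N]. Passing to the weights of
   [N] moves mass onto the larger probability, by [cover_prob_pred]. *)
apply: (@le_trans _ _ (n%:R / N.+1%:R * cover_prob R N n.-1 m +
                       (1 - n%:R / N.+1%:R) * cover_prob R N n m)).
  by apply: lerD; apply: ler_wpM2l; rewrite ?subr_ge0.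
have : 0 <= (n%:R / N%:R - n%:R / N.+1%:R) *
            (cover_prob R N n.-1 m - cover_prob R N n m).
  by rewrite mulr_ge0 ?subr_ge0.
by rewrite -[in X in _ -> X]subr_ge0; congr (0 <= _); ring.
Qed.

(* The [n.+1]-st type is missing with probability [(N / N.+1) ^+ m], and the
   draws are then uniform on the remaining [N] types. *)
Lemma cover_prob_succ N n m : (0 < N)%N ->
  cover_prob R N.+1 n.+1 m =
  cover_prob R N.+1 n m - (N%:R / N.+1%:R) ^+ m * cover_prob R N n m.
Proof.
move=> N0; elim: m n => [|m IH] n /=; first by rewrite expr0 mul1r subrr.
have N1 : N%:R != 0 :> R by rewrite pnatr_eq0 -lt0n.
case: n => [|n] /=; rewrite !IH exprS; set y := _ ^+ m.
  by field; rewrite nat1r N1 pnatr_eq0.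
by field; rewrite nat1r N1 pnatr_eq0.
Qed.

(** This is the negative correlation [F <= G]. In [cover_prob_succ], replacing the subtracted
    probability over [N] types by the smaller one over [N.+1] types shows that each further type
    costs a factor at most [1 - y]. *)
Lemma cover_prob_le N n m : (0 < N)%N -> (n <= N.+1)%N ->
  cover_prob R N.+1 n m <= (1 - (N%:R / N.+1%:R) ^+ m) ^+ n.
Proof.
move=> N0; elim: n => [|n IH] nN.
  by rewrite expr0; have /andP[] := cover_prob_itv m (ltn0Sn N) nN.
have /andP[x0 x1] := ratio_itv (ltn0Sn N) (leqnSn N).
have y0 : 0 <= (N%:R / N.+1%:R) ^+ m :> R by rewrite exprn_ge0.
have y1 : (N%:R / N.+1%:R) ^+ m <= 1 :> R by rewrite exprn_ile1.
rewrite cover_prob_succ// exprS.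
have := IH (ltnW nN); have := cover_prob_le_types m N0 nN.
set y := _ ^+ m in y0 y1 *.
move=> h1 h2.
apply: (@le_trans _ _ ((1 - y) * cover_prob R N.+1 n m)); first nra.
by apply: ler_wpM2l => //; lra.
Qed.

(** Adding the nonnegative term of index [M] and conditioning on the first draw gives
    [a S_n.+1 <= 1 + a S_n] with [a = n.+1 / N]: each further type adds at most the waiting time
    [N / n.+1]. *)
Lemma sum_uncovered_le N n M : (0 < N)%N -> (n <= N)%N ->
  \sum_(0 <= m < M) (1 - cover_prob R N n m) <= N%:R * harmonic_sum R n.
Proof.
move=> N0; elim: n M => [|n IH] M nN.
  rewrite /harmonic_sum big_ord0 mulr0 big1// => m _.
  by elim: m => /= [|m]; rewrite ?mul0r ?subrr// subr0 mul1r add0r.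
have N1 : 0 < N%:R :> R by rewrite ltr0n.
have n1 : 0 < n.+1%:R :> R by rewrite ltr0n.
rewrite /harmonic_sum big_ord_recr/= mulrDr.
set S := \sum_(0 <= m < M) _; set S' := _ * \sum_(_ < _) _.
have le1 : S <= \sum_(0 <= m < M.+1) (1 - cover_prob R N n.+1 m).
  rewrite big_nat_recr//= lerDl subr_ge0.
  by have /andP[] := cover_prob_itv M N0 nN.
have eq1 : \sum_(0 <= m < M.+1) (1 - cover_prob R N n.+1 m) =
    1 + (n.+1%:R / N%:R * \sum_(0 <= m < M) (1 - cover_prob R N n m)
         + (1 - n.+1%:R / N%:R) * S).
  rewrite big_nat_recl//= subr0; congr (_ + _).
  rewrite !mulr_sumr -big_split/=; apply: eq_bigr => m _; ring.
have /andP[a0 a1] := ratio_itv N0 nN.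
have := ler_wpM2l a0 (IH M (ltnW nN)); rewrite -/S' => h.
have {}h : n.+1%:R / N%:R * S <= 1 + n.+1%:R / N%:R * S' by lra.
rewrite -(ler_pM2l (divr_gt0 n1 N1)) mulrDr addrC.
suff -> : n.+1%:R / N%:R * (N%:R * n.+1%:R^-1) = 1 :> R by [].
by field; rewrite nat1r !gt_eqF.
Qed.

End CoverProb.

(** * Riemann sums along a geometric progression *)

Section GeometricSums.
Context {R : realType}.
Implicit Types (a b y z : R) (N n : nat).

Lemma sub_expr_bounds i a b : 0 <= b <= a ->
  i.+1%:R * b ^+ i * (a - b) <= a ^+ i.+1 - b ^+ i.+1 <=
  i.+1%:R * a ^+ i * (a - b).
Proof.
move=> /andP[b0 ba]; have a0 := le_trans b0 ba.
elim: i => [|i /andP[IH1 IH2]]; first by rewrite !expr0 !expr1 !mul1r !lexx.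
have bai : b ^+ i.+1 <= a ^+ i.+1 by apply: lerXn2r; rewrite ?nnegrE.
have -> : a ^+ i.+2 - b ^+ i.+2 = a * (a ^+ i.+1 - b ^+ i.+1) + b ^+ i.+1 * (a - b).
  by rewrite !exprS; ring.
apply/andP; split.
  have -> : i.+2%:R * b ^+ i.+1 * (a - b) =
      b * (i.+1%:R * b ^+ i * (a - b)) + b ^+ i.+1 * (a - b).
    by rewrite !exprS; ring.
  rewrite lerD2r; apply: le_trans (ler_wpM2l b0 IH1) _.
  by rewrite ler_wpM2r// subr_ge0.
have -> : i.+2%:R * a ^+ i.+1 * (a - b) =
    a * (i.+1%:R * a ^+ i * (a - b)) + a ^+ i.+1 * (a - b).
  by rewrite !exprS; ring.
by apply: lerD; [exact: ler_wpM2l|rewrite ler_wpM2r// subr_ge0].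
Qed.

(* The primitive vanishing at [0] of [y |-> (1 - (1 - y) ^+ n) / y]. *)
Let prim n y := \sum_(i < n) (1 - (1 - y) ^+ i.+1) / i.+1%:R.

(** The quotient [(1 - (1 - y) ^+ n) / y] is thus a polynomial, nonincreasing on the unit interval;
    [prim_bounds] encloses its integral by the endpoint values. *)
Lemma one_sub_exprE n y : 1 - (1 - y) ^+ n = y * \sum_(i < n) (1 - y) ^+ i.
Proof.
by apply: oppr_inj; rewrite opprB subrX1; ring.
Qed.

Let prim_bounds n y z : 0 <= z <= y -> y <= 1 ->
  (y - z) * \sum_(i < n) (1 - y) ^+ i <= prim n y - prim n z <=
  (y - z) * \sum_(i < n) (1 - z) ^+ i.
Proof.
move=> /andP[z0 zy] y1; rewrite !mulr_sumr -sumrB.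
have h (i : 'I_n) : (y - z) * (1 - y) ^+ i <=
    (1 - (1 - y) ^+ i.+1) / i.+1%:R - (1 - (1 - z) ^+ i.+1) / i.+1%:R <=
    (y - z) * (1 - z) ^+ i.
  have /(sub_expr_bounds i) : 0 <= 1 - y <= 1 - z by apply/andP; split; lra.
  have -> : 1 - z - (1 - y) = y - z by ring.
  rewrite -mulrBl ler_pdivlMr ?ltr0n// ler_pdivrMr ?ltr0n//.
  have -> : 1 - (1 - y) ^+ i.+1 - (1 - (1 - z) ^+ i.+1) =
    (1 - z) ^+ i.+1 - (1 - y) ^+ i.+1 by ring.
  have comm u : (y - z) * u * i.+1%:R = i.+1%:R * u * (y - z) by ring.
  by rewrite !comm.
by apply/andP; split; apply: ler_sum => i _; have /andP[] := h i.
Qed.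

Let prim1 n : prim n 1 = harmonic_sum R n.
Proof. by apply: eq_bigr => i _; rewrite subrr expr0n/= subr0 mul1r. Qed.

Let prim_itv n y : 0 <= y <= 1 -> 0 <= prim n y <= n%:R * y.
Proof.
move=> /andP[y0 y1]; apply/andP; split.
  apply: sumr_ge0 => i _; rewrite divr_ge0// subr_ge0 exprn_ile1//; lra.
rewrite mulr_natl -[n in _ *+ n]card_ord -sumr_const; apply: ler_sum => i _.
have /(sub_expr_bounds i) /andP[_] : 0 <= 1 - y <= 1 by apply/andP; split; lra.
rewrite !expr1n mulr1 ler_pdivrMr ?ltr0n// => /le_trans; apply.
by rewrite mulrC; apply: ler_wpM2r; rewrite ?ler0n//; lra.
Qed.

(** For [N.+1] types and [n = k * N.+1], these are the partial sums of [1 - G ^+ k]. *)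
Definition geometric_sum N n M : R :=
  \sum_(0 <= m < M) (1 - (1 - (N%:R / N.+1%:R) ^+ m) ^+ n).

(** The gap between consecutive nodes is [1 / N.+1] of the upper node and [1 / N] of the lower one.
    This is the source of the two constants in the bounds on [geometric_sum]. *)
Let geometric_step N m : (0 < N)%N ->
  let x := N%:R / N.+1%:R : R in
  [/\ 0 <= x ^+ m.+1 <= x ^+ m, x ^+ m <= 1,
      x ^+ m = N.+1%:R * (x ^+ m - x ^+ m.+1) &
      x ^+ m.+1 = N%:R * (x ^+ m - x ^+ m.+1)].
Proof.
move=> N0 x; have /andP[x0 x1] : 0 <= x <= 1 := ratio_itv (ltn0Sn N) (leqnSn N).
have N1 : N.+1%:R != 0 :> R by rewrite pnatr_eq0.
split; first by rewrite exprn_ge0//= exprS ler_piMl// exprn_ge0.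
- exact: exprn_ile1.
- by rewrite exprS; set y := _ ^+ m; rewrite /x; field; rewrite nat1r.
- by rewrite exprS; set y := _ ^+ m; rewrite /x; field; rewrite nat1r.
Qed.

(** Evaluating the integrand at the upper node of each gap underestimates its integral; the
    increments of [prim] telescope to at most [prim n 1], the harmonic sum. *)
Lemma geometric_sum_le N n M : (0 < N)%N ->
  geometric_sum N n M <= N.+1%:R * harmonic_sum R n.
Proof.
move=> N0; set x : R := N%:R / N.+1%:R.
apply: (@le_trans _ _ (N.+1%:R * \sum_(0 <= m < M)
    - (prim n (x ^+ m.+1) - prim n (x ^+ m)))).
  rewrite mulr_sumr; apply: ler_sum => m _.
  have [s1 s2 s3 s4] := geometric_step m N0.
  rewrite one_sub_exprE -/x [X in X * _ <= _]s3 -mulrA ler_wpM2l// opprB.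
  by have /andP[] := prim_bounds n s1 s2.
rewrite ler_wpM2l// sumrN telescope_sumr// expr0 prim1 opprB.
have /andP[x0 x1] : 0 <= x <= 1 := ratio_itv (ltn0Sn N) (leqnSn N).
have /(prim_itv n)/andP[] : 0 <= x ^+ M <= 1 by rewrite exprn_ge0//= exprn_ile1.
lra.
Qed.

Lemma geometric_sum_ge N n M : (0 < N)%N ->
  N%:R * (harmonic_sum R n - n%:R * (N%:R / N.+1%:R) ^+ M) <=
  geometric_sum N n M.+1.
Proof.
move=> N0; set x : R := N%:R / N.+1%:R.
have /andP[x0 x1] : 0 <= x <= 1 := ratio_itv (ltn0Sn N) (leqnSn N).
(* The term of index 0 is split off and discarded, so that the term of index [m.+1] is matched with
   the gap above its node, where it overestimates the integral. *)
rewrite /geometric_sum big_nat_recl// -/x expr0 subrr.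
apply: (@le_trans _ _ (N%:R * \sum_(0 <= m < M)
    - (prim n (x ^+ m.+1) - prim n (x ^+ m)))).
  rewrite ler_wpM2l// sumrN telescope_sumr// expr0 prim1 opprB.
  have /(prim_itv n)/andP[] : 0 <= x ^+ M <= 1 by rewrite exprn_ge0//= exprn_ile1.
  lra.
rewrite -[X in X <= _]add0r; apply: lerD.
  by rewrite subr_ge0 exprn_ile1// ler01.
rewrite mulr_sumr; apply: ler_sum => m _.
have [s1 s2 s3 s4] := geometric_step m N0.
rewrite one_sub_exprE -/x [X in _ <= X * _]s4 -mulrA ler_wpM2l// opprB.
by have /andP[] := prim_bounds n s1 s2.
Qed.

Lemma cvg_geometric_sum N n : (0 < N)%N ->
  exists2 l : R, geometric_sum N n @ \oo --> l &
    N%:R * harmonic_sum R n <= l <= N.+1%:R * harmonic_sum R n.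
Proof.
move=> N0; set x : R := N%:R / N.+1%:R.
have /andP[x0 x1] : 0 <= x <= 1 := ratio_itv (ltn0Sn N) (leqnSn N).
have nd : nondecreasing_seq (geometric_sum N n).
  apply/nondecreasing_seqP => M; rewrite /geometric_sum big_nat_recr//= lerDl.
  have h : 0 <= x ^+ M <= 1 by rewrite exprn_ge0//= exprn_ile1.
  by rewrite subr_ge0 exprn_ile1//; lra.
have ub M := geometric_sum_le n M N0.
have cv : cvgn (geometric_sum N n).
  apply: nondecreasing_is_cvgn => //.
  by exists (N.+1%:R * harmonic_sum R n) => _ [M _ <-].
exists (limn (geometric_sum N n)) => //; apply/andP; split; last first.
  by apply: limr_le => //; exact: nearW.
have cx : N%:R * (harmonic_sum R n - n%:R * x ^+ M) @[M --> \oo] -->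
    (N%:R * (harmonic_sum R n - n%:R * 0) : R).
  apply: cvgMl_tmp; apply: cvgB; first exact: cvg_cst.
  apply: cvgMl_tmp; apply: cvg_expr.
  by rewrite ger0_norm// ltr_pdivrMr ?ltr0n// mul1r ltr_nat.
rewrite mulr0 subr0 in cx.
apply: (ler_cvg_to cx (cvg_cst (limn (geometric_sum N n)))).
apply: nearW => M; apply: le_trans (geometric_sum_ge n M N0) _.
exact: nondecreasing_cvgn_le.
Qed.

End GeometricSums.

Definition collection_tail (R : fieldType) (N m : nat) : R :=
  1 - cover_prob R N N m.

(** * Replacing the exact tails by the product approximation *)

Section MinOfCollectors.
Context {R : realType}.
Implicit Types N p : nat.

(** Subtracting [(1 - 1) ^+ p = 0] from the binomial expansion removes the constant term and turns
    each power of [g] into [1 - g ^+ j.+1], which is summable over the draws when [g] is [G m]. *)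
Lemma one_sub_expr_binomial p (g : R) : (0 < p)%N ->
  (1 - g) ^+ p = \sum_(j < p) (-1) ^+ j * 'C(p, j.+1)%:R * (1 - g ^+ j.+1).
Proof.
move=> p0; transitivity ((1 - g) ^+ p - (1 - 1) ^+ p).
  by rewrite subrr expr0n gtn_eqF// subr0.
rewrite !exprBn -sumrB big_ord_recl/= !expr0 subrr add0r.
apply: eq_bigr => j _; rewrite /bump/= add1n !expr1n !mulr1.
rewrite -mulrnBl -[LHS]mulr_natr [(-1) ^+ _]exprS.
by move: 'C(_, _)%:R ((-1) ^+ j) (g ^+ _) => *; ring.
Qed.

Lemma sum_signed_binomial p : (0 < p)%N ->
  \sum_(j < p) (-1) ^+ j * 'C(p, j.+1)%:R = 1 :> R.
Proof.
move=> p0; have := one_sub_expr_binomial 0 p0.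
rewrite subr0 expr1n => h; rewrite [RHS]h; apply: eq_bigr => j _.
by rewrite expr0n/= subr0 mulr1.
Qed.

Lemma sub_expr_le_natr p (f g : R) : 0 <= g <= f -> f <= 1 ->
  0 <= f ^+ p - g ^+ p <= p%:R * (f - g).
Proof.
move=> /andP[g0 gf] f1.
case: p => [|p]; first by rewrite !expr0 subrr mul0r lexx.
have /(sub_expr_bounds p)/andP[_ h] : 0 <= g <= f by rewrite g0.
have f0 := le_trans g0 gf.
rewrite subr_ge0 lerXn2r ?nnegrE//=; apply: le_trans h _.
by rewrite ler_wpM2r ?subr_ge0// ler_piMr// exprn_ile1.
Qed.

Lemma collection_tail_itv N m : (0 < N)%N -> 0 <= collection_tail R N m <= 1.
Proof.
move=> N0; have /andP[] := @cover_prob_itv R _ _ m N0 (leqnn N).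
by rewrite /collection_tail => *; apply/andP; split; lra.
Qed.

Lemma sum_collection_tail_exp_le N p M : (0 < N)%N -> (0 < p)%N ->
  \sum_(0 <= m < M) collection_tail R N m ^+ p <= N%:R * harmonic_sum R N.
Proof.
move=> N0 p0; apply: le_trans (sum_uncovered_le M N0 (leqnn N)).
apply: ler_sum => m _; rewrite -[X in _ <= X]expr1.
have /andP[h0 h1] := collection_tail_itv m N0.
exact: ler_wiXn2l.
Qed.

(** The first error term pays for replacing [F] by [G], the second for replacing each limit of
    [geometric_sum] by its upper bound. *)
Lemma sum_collection_tail_exp_lim N p (L : R) : (0 < N)%N -> (0 < p)%N ->
  \sum_(0 <= m < M) collection_tail R N.+1 m ^+ p @[M --> \oo] --> L ->
  `|L - \sum_(j < p) (-1) ^+ j * 'C(p, j.+1)%:R *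
        (N.+1%:R * harmonic_sum R (N.+1 * j.+1))| <=
  p%:R * harmonic_sum R N.+1 +
  \sum_(j < p) 'C(p, j.+1)%:R * harmonic_sum R (N.+1 * j.+1).
Proof.
move=> N0 p0 cvL.
have [l cvl lb] : exists2 l : nat -> R,
    forall j, geometric_sum N (N.+1 * j.+1) @ \oo --> l j &
    forall j, N%:R * harmonic_sum R (N.+1 * j.+1) <= l j <=
      N.+1%:R * harmonic_sum R (N.+1 * j.+1).
  pose P j := cvg_geometric_sum (N.+1 * j.+1) N0 (R := R).
  exists (fun j => projT1 (cid2 (P j))) => j; by case: (cid2 (P j)).
set x : R := N%:R / N.+1%:R; set G := fun m => (1 - x ^+ m) ^+ N.+1.
have /andP[x0 x1] : 0 <= x <= 1 := ratio_itv (ltn0Sn N) (leqnSn N).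
have FG m : 0 <= 1 - G m <= collection_tail R N.+1 m.
  have ? : 0 <= x ^+ m <= 1 by rewrite exprn_ge0//= exprn_ile1.
  rewrite subr_ge0 exprn_ile1 ?lerD2l ?lerN2//=; [|lra|lra].
  exact: cover_prob_le.
pose D M := \sum_(0 <= m < M) collection_tail R N.+1 m ^+ p -
  \sum_(j < p) (-1) ^+ j * 'C(p, j.+1)%:R * geometric_sum N (N.+1 * j.+1) M.
have DE M : D M =
    \sum_(0 <= m < M) (collection_tail R N.+1 m ^+ p - (1 - G m) ^+ p).
  rewrite sumrB; congr (_ - _).
  under [RHS]eq_bigr do rewrite one_sub_expr_binomial//.
  rewrite exchange_big/=; apply: eq_bigr => j _.
  rewrite -mulr_sumr; congr (_ * _); apply: eq_bigr => m _.
  by rewrite /G -exprM.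
(* The power [p] is [p]-Lipschitz on the unit interval, so the defect is at most [p] times the sum
   of [G - F]; the factor [1] in [N.+1 * 1] matches the case [j = 0] of [l]. *)
have D0 M : 0 <= D M <= p%:R * (N.+1%:R * harmonic_sum R N.+1 -
      geometric_sum N (N.+1 * 1) M).
  have h m : 0 <= collection_tail R N.+1 m ^+ p - (1 - G m) ^+ p <=
      p%:R * (collection_tail R N.+1 m - (1 - G m)).
    have /andP[_ f1] := collection_tail_itv m (ltn0Sn N).
    exact: sub_expr_le_natr.
  rewrite DE sumr_ge0/= => [|m _]; last by have /andP[] := h m.
  apply: (@le_trans _ _ (p%:R * \sum_(0 <= m < M)
     (collection_tail R N.+1 m - (1 - G m)))).
    by rewrite mulr_sumr; apply: ler_sum => m _; have /andP[] := h m.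
  rewrite ler_wpM2l// sumrB muln1 lerD2r.
  exact: sum_uncovered_le.
have cvD : D @ \oo --> L - \sum_(j < p) (-1) ^+ j * 'C(p, j.+1)%:R * l j.
  apply: cvgB => //.
  apply: cvg_big => [|j _]; [exact: add_continuous|exact: cvgMl_tmp].
have dl : 0 <= L - \sum_(j < p) (-1) ^+ j * 'C(p, j.+1)%:R * l j <=
    p%:R * harmonic_sum R N.+1.
  apply/andP; split.
    by apply: (ler_cvg_to (cvg_cst 0) cvD); apply: nearW => M; have /andP[] := D0 M.
  (* In the limit the bounds [N.+1 * H] and [N * H] nearly cancel, leaving a single harmonic sum. *)
  apply: (@le_trans _ _ (p%:R * (N.+1%:R * harmonic_sum R N.+1 - l 0%N))).
    apply: (ler_cvg_to cvD (g := fun M => p%:R * (N.+1%:R * harmonic_sum R N.+1 -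
        geometric_sum N (N.+1 * 1) M))).
      by apply: cvgMl_tmp; apply: cvgB; [exact: cvg_cst|exact: cvl].
    by apply: nearW => M; have /andP[] := D0 M.
  rewrite ler_wpM2l//; have /andP[+ _] := lb 0%N.
  by rewrite muln1 -natr1; lra.
set W := \sum_(j < p) _ * l j in dl.
rewrite -(subrKA W); apply: le_trans (ler_normD _ _) _; apply: lerD.
  by have /andP[? ?] := dl; rewrite ger0_norm.
rewrite -sumrB; apply: le_trans (ler_norm_sum _ _ _) _; apply: ler_sum => j _.
rewrite -mulrBr !normrM normrX normrN1 expr1n mul1r normr_nat ler_wpM2l//.
by have /andP[] := lb j; rewrite ler_norml -natr1 => *; apply/andP; split; lra.
Qed.

End MinOfCollectors.

(** * Harmonic sums and the Euler constant *)

Section HarmonicAsymptotics.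
Context {R : realType}.
Implicit Types n k : nat.

Lemma ln_succ_bounds n : (0 < n)%N ->
  n.+1%:R^-1 <= (ln n.+1%:R - ln n%:R : R) <= n%:R^-1.
Proof.
move=> n0; have n1 : 0 < n%:R :> R by rewrite ltr0n.
have n2 : 0 < n.+1%:R :> R by rewrite ltr0n.
rewrite -ln_div ?posrE//; apply/andP; split.
  rewrite -lerN2 -lnV ?posrE ?divr_gt0// invf_div.
  have -> : n%:R / n.+1%:R = 1 + - n.+1%:R^-1 :> R by field; rewrite nat1r gt_eqF.
  by apply: le_ln1Dx; rewrite ltrN2 invf_lt1// ltr1n.
have -> : n.+1%:R / n%:R = 1 + n%:R^-1 :> R by field; rewrite gt_eqF.
by apply: le_ln1Dx; apply: (@lt_trans _ _ 0); rewrite ?invr_gt0// oppr_lt0.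
Qed.

(** By [ln_succ_bounds], [u n] is nonincreasing and [u n - n^-1] nondecreasing from 1 on; both tend
    to the Euler constant, which therefore lies between them. *)
Lemma harmonic_sum_sub_ln_bounds n : (0 < n)%N ->
  0 <= harmonic_sum R n - ln n%:R - euler_gamma R <= n%:R^-1.
Proof.
pose u n : R := harmonic_sum R n - ln n%:R.
have step k : (0 < k)%N -> u k.+1 <= u k /\ u k - k%:R^-1 <= u k.+1 - k.+1%:R^-1.
  move=> k0; rewrite /u /harmonic_sum big_ord_recr/=.
  have /andP[h1 h2] := ln_succ_bounds k0.
  move: (\sum_(_ < _) _) (k.+1%:R^-1) (k%:R^-1) (ln k.+1%:R) (ln k%:R) h1 h2.
  by move=> *; split; lra.
have mono k m : (0 < k)%N -> u (k + m)%N <= u k /\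
    u k - k%:R^-1 <= u (k + m)%N - (k + m)%:R^-1.
  move=> k0; elim: m => [|m [IH1 IH2]]; first by rewrite addn0.
  have [|s1 s2] := step (k + m)%N; first by rewrite addn_gt0 k0.
  by rewrite addnS; split; [exact: le_trans s1 _|exact: le_trans IH2 _].
have lo k m : (0 < k)%N -> (k <= m)%N -> u k - k%:R^-1 <= u m.
  move=> k0 /subnKC <-; have [_ /le_trans] := mono k (m - k)%N k0; apply.
  by rewrite gerBl invr_ge0.
have cv : cvgn u.
  apply: (@near_nonincreasing_is_cvgn _ u (u 1%N - 1)).
    exists 1%N => // k /= k0 m km.
    by rewrite -(subnKC km); have [] := mono k (m - k)%N k0.
  exists 1%N => // k /= k0; have := lo 1%N k isT k0.
  by rewrite invr1.
have -> : euler_gamma R = limn u.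
  congr (limn _); apply/funext => k; rewrite /u /harmonic_sum.
  by rewrite big_add1/= big_mkord.
move=> n0; apply/andP; split.
  rewrite subr_ge0; apply: limr_le => //.
  by exists n => // m /= nm; rewrite -(subnKC nm); have [] := mono n (m - n)%N n0.
rewrite lerBlDl -lerBlDr; apply: limr_ge => //.
by exists n => // m /= nm; exact: lo.
Qed.

Lemma harmonic_sum_le_ln n : (0 < n)%N -> harmonic_sum R n <= 1 + ln n%:R.
Proof.
elim: n => // n IH _; rewrite /harmonic_sum big_ord_recr/=.
case: n => [|n] in IH *; first by rewrite big_ord0 invr1 ln1; lra.
have /andP[] := ln_succ_bounds (ltn0Sn n); have := IH isT.
rewrite /harmonic_sum.
by move: (\sum_(_ < _) _) (n.+2%:R^-1) (ln _) (ln _) => *; lra.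
Qed.

End HarmonicAsymptotics.

(** * The asymptotic expansion *)

Section Asymptotics.
Context {R : realType}.
Implicit Types N p : nat.

(** The absorption identity [p * 'C(p.-1, j) = j.+1 * 'C(p, j.+1)] cancels the denominators. *)
Lemma min_constE p : (0 < p)%N ->
  p%:R * min_const R p =
  \sum_(j < p) (-1) ^+ j * 'C(p, j.+1)%:R * ln j.+1%:R.
Proof.
move=> p0; rewrite /min_const big_mkord mulr_sumr; apply: eq_bigr => j _.
rewrite nat1r.
have -> : p%:R * ((-1) ^+ j * 'C(p.-1, j)%:R * (ln j.+1%:R / j.+1%:R)) =
  (p * 'C(p.-1, j))%:R / j.+1%:R * ((-1) ^+ j * ln j.+1%:R) :> R.
  rewrite natrM; move: (j.+1%:R^-1) (ln _) => *; ring.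
rewrite mul_bin_diag natrM [_ * _ / _]mulrAC divff ?pnatr_eq0// mul1r.
by rewrite mulrCA mulrA.
Qed.

(** Chosen so that [H_(N j.+1) + 1 <= 2 + ln N + ln j.+1 <= (2 + ln j.+1) (1 + ln N)]; the added 1
    absorbs the error of [harmonic_mean_asymptotics]. *)
Let coef p := \sum_(j < p) 'C(p, j.+1)%:R * (2 + ln j.+1%:R) : R.

(** The signed binomials sum to 1, which isolates [ln N + gamma], and the terms [ln j.+1] assemble
    into [p * min_const]. Each harmonic error, at most [1 / N], is multiplied by [N]. *)
Lemma harmonic_mean_asymptotics N p : (0 < N)%N -> (0 < p)%N ->
  `|\sum_(j < p) (-1) ^+ j * 'C(p, j.+1)%:R *
      (N%:R * harmonic_sum R (N * j.+1)) -
    N%:R * (ln N%:R + (euler_gamma R + p%:R * min_const R p))| <=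
  \sum_(j < p) 'C(p, j.+1)%:R.
Proof.
move=> N0 p0.
have Npos : 0 < N%:R :> R by rewrite ltr0n.
have -> : N%:R * (ln N%:R + (euler_gamma R + p%:R * min_const R p)) =
    \sum_(j < p) (-1) ^+ j * 'C(p, j.+1)%:R *
      (N%:R * (ln (N * j.+1)%:R + euler_gamma R)).
  rewrite min_constE// addrA [RHS](eq_bigr (fun j : 'I_p =>
      (-1) ^+ j * 'C(p, j.+1)%:R * (N%:R * (ln N%:R + euler_gamma R)) +
      N%:R * ((-1) ^+ j * 'C(p, j.+1)%:R * ln j.+1%:R))); last first.
    move=> j _; rewrite natrM lnM ?posrE ?ltr0n//.
    by move: ('C(_, _)%:R) ((-1) ^+ j) (ln _) (ln _) => *; ring.
  by rewrite big_split/= -mulr_suml sum_signed_binomial// mul1r -mulr_sumr mulrDr.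
rewrite -sumrB; apply: le_trans (ler_norm_sum _ _ _) _; apply: ler_sum => j _.
rewrite -mulrBr !normrM normrX normrN1 expr1n mul1r normr_nat.
rewrite -mulrBr normrM normr_nat ler_piMr// opprD addrA.
have Nj : (0 < N * j.+1)%N by rewrite muln_gt0 N0.
have /andP[h0 h1] := harmonic_sum_sub_ln_bounds (R := R) Nj.
rewrite ger0_norm// -ler_pdivlMl// mulr1; apply: le_trans h1 _.
by rewrite lef_pV2 ?posrE ?ltr0n// ler_nat leq_pmulr.
Qed.

Lemma collection_tail_asymptotics N p (L : R) : (1 < N)%N -> (0 < p)%N ->
  \sum_(0 <= m < M) collection_tail R N m ^+ p @[M --> \oo] --> L ->
  `|L - N%:R * (ln N%:R + (euler_gamma R + p%:R * min_const R p))| <=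
  (p%:R + coef p) * (1 + ln N%:R).
Proof.
case: N => // N N0 p0 /(sum_collection_tail_exp_lim N0 p0).
have := harmonic_mean_asymptotics (ltn0Sn N) p0.
set W := \sum_(_ < _) _ * (_ * harmonic_sum _ _) => h1 h2.
rewrite -(subrKA W); apply: le_trans (ler_normD _ _) _.
apply: le_trans (lerD h2 h1) _.
rewrite -addrA -big_split/= mulrDl; apply: lerD.
  by rewrite ler_wpM2l//; exact: harmonic_sum_le_ln.
rewrite mulr_suml; apply: ler_sum => j _.
rewrite -[X in _ + X]mulr1 -mulrDr -mulrA ler_wpM2l//.
have Nj : (0 < N.+1 * j.+1)%N by [].
apply: (@le_trans _ _ (1 + ln (N.+1 * j.+1)%:R + 1)).
  by rewrite lerD2r; exact: harmonic_sum_le_ln.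
rewrite natrM lnM ?posrE ?ltr0n//.
have := @ln_ge0 R N.+1%:R; rewrite ler1n => /(_ isT) a0.
have := @ln_ge0 R j.+1%:R; rewrite ler1n => /(_ isT) b0.
move: (ln _) (ln _) a0 b0 => a b a0 b0; nra.
Qed.

Lemma expected_min_asymptotics p (L : nat -> R) : (0 < p)%N ->
  (forall N, (0 < N)%N ->
     \sum_(0 <= m < M) collection_tail R N m ^+ p @[M --> \oo] --> L N) ->
  exists eps : nat -> R,
    (forall N, (0 < N)%N ->
       L N = N%:R * (ln N%:R + (euler_gamma R + p%:R * min_const R p) + eps N)) /\
    eps =O_\oo (fun N : nat => ln N%:R ^+ 2 / N%:R).
Proof.
move=> p0 cvL; set A := euler_gamma R + p%:R * min_const R p.
exists (fun N => L N / N%:R - (ln N%:R + A)); split => [N N0|].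
  by rewrite addrC subrK mulrC divfK// pnatr_eq0 -lt0n.
have c0 : 0 < ln 2 :> R by rewrite ln_gt0// ltr1n.
have K0 : 0 <= p%:R + coef p.
  rewrite addr_ge0//; apply: sumr_ge0 => j _; rewrite mulr_ge0// addr_ge0//.
  by rewrite ln_ge0// ler1n.
(* Put [u = ln N] and [v = (ln 2)^-1]. For [N >= 2], [u v >= 1] yields
   [1 + u <= (v ^+ 2 + v) u ^+ 2]; the final [+ 1] makes the constant positive. *)
apply/eqO_exP; exists ((p%:R + coef p) * (ln 2 ^- 2 + (ln 2)^-1) + 1).
  by rewrite ltr_pwDr// mulr_ge0// addr_ge0// invr_ge0 ?exprn_ge0// ltW.
exists 2%N => // N /= N2; have N0 : (0 < N)%N by exact: ltn_trans N2.
have Npos : 0 < N%:R :> R by rewrite ltr0n.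
have := collection_tail_asymptotics N2 p0 (cvL N N0).
rewrite -/A => h.
have -> : L N / N%:R - (ln N%:R + A) = (L N - N%:R * (ln N%:R + A)) / N%:R.
  by field; rewrite gt_eqF.
have lnN : ln 2 <= ln N%:R :> R by rewrite ler_ln ?posrE ?ltr0n// ler_nat.
have ratio : 1 <= ln N%:R / ln 2 :> R by rewrite ler_pdivlMr// mul1r.
rewrite !(normrM _ N%:R^-1) normfV normr_nat mulrA ler_wpM2r ?invr_ge0//.
apply: le_trans h _; rewrite [`|ln _ ^+ 2|]ger0_norm ?sqr_ge0//.
have u0 : 0 <= ln N%:R ^+ 2 :> R by rewrite sqr_ge0.
apply: (@le_trans _ _ ((p%:R + coef p) * ((ln 2 ^- 2 + (ln 2)^-1) * ln N%:R ^+ 2))).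
  rewrite ler_wpM2l// -exprVn; move: ratio u0.
  set u := ln N%:R; set v := (ln 2)^-1 => ratio u0.
  have -> : (v ^+ 2 + v) * u ^+ 2 = (u * v) ^+ 2 + (u * v) * u by ring.
  apply: lerD; first by rewrite exprn_ege1.
  by rewrite ler_peMl// (le_trans _ lnN)// ltW.
by rewrite mulrA [X in _ <= X]mulrDl mul1r lerDl.
Qed.

End Asymptotics.

(** * Counting covering words and Stirling numbers *)

Section Stirling.
Local Open Scope set_scope.
Implicit Types N k m : nat.

Definition covering_count (T : finType) (D : {set T}) m : nat :=
  #|[set t : m.-tuple T | [forall x in D, x \in t]]|.

Lemma covering_countS (T : finType) (D : {set T}) m :
  covering_count D m.+1 = (\sum_(x : T) covering_count (D :\ x) m)%N.
Proof.
rewrite /covering_count -sum1dep_card.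
pose cons_pair (u : T * m.-tuple T) : m.+1.-tuple T := [tuple of u.1 :: u.2].
have bij : {on [pred t : m.+1.-tuple T | [forall x in D, x \in t]],
    bijective cons_pair}.
  exists (fun t => (thead t, [tuple of behead t])) => [[x t] _|t _] /=.
    by congr pair; apply/val_inj.
  by rewrite [RHS]tuple_eta; apply: val_inj.
rewrite (reindex cons_pair)//=.
under [RHS]eq_bigr do rewrite -sum1dep_card.
rewrite pair_big_dep/=; apply: eq_bigl => -[x t] /=.
apply/forall_inP/forall_inP => [h y|h y yD].
  by rewrite !inE => /andP[yx /h]; rewrite inE (negbTE yx).
rewrite inE; have [//|yx] := eqVneq y x; apply: h.
by rewrite !inE yx.
Qed.

(** Splitting on the first letter gives the recurrence of [cover_prob]: the [#|D|] letters of [D]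
    each remove one requirement, the others none. *)
Lemma covering_countE (R : realFieldType) (T : finType) (D : {set T}) m :
  (0 < #|T|)%N ->
  (covering_count D m)%:R / #|T|%:R ^+ m = cover_prob R #|T| #|D| m.
Proof.
move=> T0; have T1 : #|T|%:R != 0 :> R by rewrite pnatr_eq0 -lt0n.
elim: m D => [|m IH] D /=.
  rewrite expr0 divr1 /covering_count; congr (_%:R).
  have -> : [set t : 0.-tuple T | [forall x in D, x \in t]] =
      if D == finset.set0 then [set: 0.-tuple T] else finset.set0.
    apply/setP => t; case: eqVneq => [->|/set0Pn[x xD]]; rewrite !inE.
      by apply/forall_inP => x; rewrite inE.
    by apply/negbTE/forall_inPn; exists x; rewrite // tuple0 in_nil.
  rewrite cards_eq0; case: eqP => _; last by rewrite cards0.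
  by rewrite cardsT card_tuple expn0.
rewrite covering_countS natr_sum mulr_suml exprS.
rewrite (bigID (mem D))/=.
rewrite (eq_bigr (fun=> #|T|%:R^-1 * cover_prob R #|T| #|D|.-1 m)); last first.
  move=> x xD; rewrite -[in RHS](_ : #|D :\ x| = #|D|.-1) -?IH; last first.
    by rewrite (cardsD1 x D) xD.
  by rewrite invfM mulrCA.
rewrite sumr_const [X in _ + X](eq_bigr (fun=>
    #|T|%:R^-1 * cover_prob R #|T| #|D| m)); last first.
  move=> x xD; have -> : D :\ x = D.
    by apply/setP => y; rewrite !inE; case: eqVneq => // ->; rewrite (negbTE xD).
  by rewrite -IH invfM mulrCA.
rewrite sumr_const.
have -> : #|[pred i | i \notin D]| = (#|T| - #|D|)%N.
  by rewrite -(cardsC D) addKn; apply: eq_card => x; rewrite !inE.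
rewrite -[_ *+ #|_|]mulr_natl -[_ *+ (_ - _)]mulr_natl natrB ?max_card//.
by field.
Qed.

(** A word using every letter amounts to its family of fibres, an injective labelling by ['I_N] of
    the blocks of a partition of the positions. *)
Lemma covering_count_stirling2 k N :
  covering_count [set: 'I_N] k = (stirling2 k N * N`!)%N.
Proof.
pose inj := [set g : {ffun 'I_N -> {set 'I_k}} |
  injectiveb g && finset.partition [set g x | x in [set: 'I_N]] [set: 'I_k]].
pose fib (t : k.-tuple 'I_N) : {ffun 'I_N -> {set 'I_k}} :=
  [ffun j => [set i | tnth t i == j]].
transitivity #|inj|.
  have fib_inj : injective fib.
    move=> t u tu; apply: eq_from_tnth => i.
    have : i \in fib t (tnth t i) by rewrite ffunE inE.
    by rewrite tu ffunE inE => /eqP.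
  rewrite /covering_count -(card_imset _ fib_inj); apply: eq_card => g.
  apply/imsetP/idP => [[t]|].
    rewrite inE => /forall_inP t_onto ->{g}.
    have pick j : exists i, tnth t i = j.
      by have /tnthP[i ->] := t_onto j (finset.in_setT j); exists i.
    rewrite inE; apply/andP; split.
      apply/injectiveP => j j' /setP jj'; have [i ij] := pick j.
      by have := jj' i; rewrite !ffunE !inE ij eqxx => /esym/eqP.
    apply/and3P; split.
    - rewrite finset.eqEsubset finset.subsetT/=; apply/fintype.subsetP => i _.
      apply/bigcupP; exists (fib t (tnth t i)); last by rewrite ffunE inE.
      exact: imset_f.
    - apply/finset.trivIsetP => _ _ /imsetP[j _ ->] /imsetP[j' _ ->] jj'.
      rewrite -finset.setI_eq0; apply/eqP/setP => i; rewrite !ffunE !inE.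
      apply/negbTE/negP => /andP[/eqP ij /eqP ij'].
      by rewrite -ij -ij' eqxx in jj'.
    - apply/imsetP => -[j _ /setP e]; have [i ij] := pick j.
      by have := e i; rewrite ffunE !inE ij eqxx.
  rewrite inE => /andP[/injectiveP g_inj /and3P[/eqP cov /finset.trivIsetP triv n0]].
  have pick i : exists j, i \in g j.
    have : i \in finset.cover [set g x | x in [set: 'I_N]] by rewrite cov inE.
    by case/bigcupP => _ /imsetP[j _ ->] ij; exists j.
  have uniq i j j' : i \in g j -> i \in g j' -> j = j'.
    move=> ij ij'; apply/g_inj/eqP; apply: contraTT ij => /triv.
    by rewrite !imset_f// => /(_ isT isT)/disjointFl/(_ ij') ->.
  (* Inverse of [fib]: position [i] receives the unique label whose block contains it. *)
  pose t := [tuple xchoose (pick i) | i < k].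
  exists t; last first.
    apply/ffunP => j; apply/setP => i; rewrite ffunE inE tnth_mktuple.
    apply/idP/eqP => [ij|<-]; last exact: (xchooseP (pick i)).
    exact: uniq (xchooseP (pick i)) ij.
  rewrite inE; apply/forall_inP => j _; apply/tnthP.
  have /set0Pn[i ij] : g j != finset.set0.
    by apply: contraNneq n0 => <-; exact: imset_f.
  exists i; rewrite tnth_mktuple; exact: uniq ij (xchooseP (pick i)).
(* Labellings are grouped by their underlying partition; each one with [N] blocks has [N ^_ N = N!]
   of them. *)
rewrite -sum1_card (partition_big (fun g : {ffun _} => [set g x | x in [set: 'I_N]])
  (mem [pred B : {set {set 'I_k}} | finset.partition B [set: 'I_k] & #|B| == N]))/=.
  rewrite /stirling2 -sum_nat_const; apply: eq_bigr => B.
  rewrite inE/= => /andP[partB /eqP cardB].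
  rewrite sum1_card -ffactnn -[X in (X ^_ _)%N]cardB -[X in (_ ^_ X)%N]card_ord.
  rewrite -card_inj_ffuns_on; apply: eq_card => g.
  rewrite -[LHS]/((g \in inj) && ([set g x | x in [set: 'I_N]] == B)) !inE.
  case: (boolP (injectiveb g)) => [/injectiveP g_inj|]; last by rewrite andbF.
  have cardg : #|[set g x | x in [set: 'I_N]]| = N.
    by rewrite card_imset// cardsT card_ord.
  rewrite /= andbT; apply/andP/forallP => [[_ /eqP <-] x|gB]; first exact: imset_f.
  have -> : [set g x | x in [set: 'I_N]] = B.
    apply/eqP; rewrite eqEcard cardg cardB leqnn andbT.
    by apply/fintype.subsetP => _ /imsetP[x _ ->].
  by [].
move=> g; rewrite !inE => /andP[/injectiveP g_inj ->] /=.
by rewrite card_imset// cardsT card_ord.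
Qed.

End Stirling.

(** * Values of the collection time *)

Section CollectionTime.
Context {R : realType}.
Implicit Types (N k : nat) (x : nat -> nat).

Definition collected N x k : Prop :=
  forall j : nat, (j < N)%N -> exists2 n : nat, (n < k)%N & x n = j.

Lemma collected_le N x k m : (k <= m)%N -> collected N x k -> collected N x m.
Proof.
move=> km h j /h[n nk <-]; exists n => //; exact: leq_trans km.
Qed.

Lemma collection_time_le N x k :
  (collection_time R N x <= k%:R%:E)%E <-> collected N x k.
Proof.
split=> [|h]; last by apply: ereal_inf_lbound; exists k.
apply: contraPP => nh; apply/negP; rewrite -ltNge.
(* Completeness persists under further draws, so failure at [k] forces every admissible index, hence
   the infimum, to be at least [k.+1]. *)
apply: (@lt_le_trans _ _ k.+1%:R%:E); first by rewrite lte_fin ltr_nat.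
apply: le_ereal_inf_tmp => _ [m hm <-]; rewrite lee_fin ler_nat ltnNge.
by apply/negP => mk; apply: nh; exact: collected_le hm.
Qed.

Lemma collection_time_nat N x :
  (exists k : nat, collection_time R N x = k%:R%:E) \/
  collection_time R N x = +oo%E.
Proof.
have [[k hk]|h] := pselect (exists k, collected N x k); [left|right].
  have [|m /asboolP hm mmin] := @ex_minnP (fun k => `[< collected N x k >]).
    by exists k; apply/asboolP.
  exists m; apply/eqP; rewrite eq_le; apply/andP; split.
    exact/collection_time_le.
  apply: le_ereal_inf_tmp => _ [l hl <-]; rewrite lee_fin ler_nat.
  by apply: mmin; apply/asboolP.
rewrite /collection_time (_ : mkset _ = set0) ?image_set0 ?ereal_inf0//.
by apply/seteqP; split => // k hk; apply: h; exists k.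
Qed.

End CollectionTime.

(** * Law of the first draws *)

Section UniformDraws.
Context (d : measure_display) (W : measurableType d) (R : realType).
Variables (Q : probability W R) (N : nat) (X : nat -> {RV Q >-> nat}).
Hypotheses (N0 : (0 < N)%N) (unifX : uniform_draws N X).

(** The cylinder on which the first [k] draws spell [t], written over a list of indices to fit
    [mutually_independent]; the default of [nth] is never reached. *)
Let atom k (t : k.-tuple 'I_N) : set W :=
  \bigcap_(n in [set` iota 0 k]) X n @^-1` [set nth 0%N (map val t) n].

Let atomP k (t : k.-tuple 'I_N) w :
  atom t w <-> forall i : 'I_k, X i w = tnth t i :> nat.
Proof.
have nthE (i : 'I_k) : nth 0%N (map val t) i = tnth t i.
  by rewrite (nth_map (tnth t i)) ?size_tuple// -tnth_nth.
split=> [h i|h n /=]; first by rewrite -nthE; apply: h; rewrite /= mem_iota/=.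
by rewrite mem_iota/= => nk; have := h (Ordinal nk); rewrite -nthE.
Qed.

Let measurable_atom k (t : k.-tuple 'I_N) : measurable (atom t).
Proof.
apply: fin_bigcap_measurable => // n _.
by rewrite -[X in measurable X]setTI; exact: measurable_funP.
Qed.

Let prob_atom k (t : k.-tuple 'I_N) : Q (atom t) = (N%:R ^- k)%:E.
Proof.
have [indX _ unif] := unifX.
rewrite /atom (indX _ (fun n => [set nth 0%N (map val t) n])) ?iota_uniq//.
rewrite (eq_big_seq (fun=> (N%:R^-1)%:E)) => [|n]; last first.
  rewrite mem_iota/= add0n => nk; apply: unif.
  by rewrite (nth_map (Ordinal N0)) ?size_tuple//.
rewrite big_const_seq count_predT size_iota -exprVn.
by elim: k {t} => [|k IH]; rewrite ?expr0// iterS IH -EFinM exprS.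
Qed.

Let onto k : {set k.-tuple 'I_N} :=
  [set t : k.-tuple 'I_N | [forall x in [set: 'I_N], x \in t]]%SET.

Let collected_atoms k : [set w | collected N (fun n => X n w) k] =
  \bigcup_(t in [set` onto k]) atom t.
Proof.
have [_ ltX _] := unifX.
apply/seteqP; split => w.
  move=> /= h; pose t := [tuple Ordinal (ltX i w) | i < k].
  exists t; last by apply/atomP => i; rewrite tnth_mktuple.
  rewrite /= /onto inE; apply/forall_inP => j _; apply/tnthP.
  have [n nk nj] := h j (ltn_ord j).
  by exists (Ordinal nk); rewrite tnth_mktuple; apply: val_inj => /=.
move=> [t /=]; rewrite inE => /forall_inP t_onto /atomP tw j jN.
have /tnthP[i ij] := t_onto (Ordinal jN) (finset.in_setT _).
by exists i => //; rewrite tw -ij.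
Qed.

Lemma measurable_collected k :
  measurable [set w | collected N (fun n => X n w) k].
Proof.
rewrite collected_atoms; apply: fin_bigcup_measurable => [|t _].
  exact: finite_finpred.
exact: measurable_atom.
Qed.

(** The event is a finite disjoint union of cylinders of probability [N ^- k], so the probability
    reduces to [covering_count]. *)
Lemma prob_collected k :
  Q [set w | collected N (fun n => X n w) k] = (cover_prob R N N k)%:E.
Proof.
rewrite collected_atoms measure_fin_bigcup//=; last first.
  move=> t u _ _ [w [/atomP tw /atomP uw]]; apply: eq_from_tnth => i.
  by apply: val_inj; rewrite /= -tw -uw.
rewrite (eq_fsbigr (fun=> (N%:R ^- k)%:E)) => [|t _]; last exact: prob_atom.
rewrite (fsbigE (enum (onto k))) ?enum_uniq//=; first last.
- by move=> t; rewrite mem_enum => ->.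
- by move=> t /=; rewrite mem_enum.
have := @covering_countE R 'I_N [set: 'I_N]%SET k; rewrite cardsT card_ord => <-//.
rewrite big_seq_cond (eq_bigl (fun t => t \in enum (onto k))); last first.
  by move=> t; rewrite mem_enum mem_setE andbb.
rewrite -big_seq sumEFin big_const_seq count_predT -cardE; congr (_%:E).
by rewrite /covering_count iter_addr_0 mulr_natl.
Qed.

End UniformDraws.

(** * Expectation of the minimum as a series of tails *)

Section ExpectedMin.
Context {R : realType}.

Definition nat_or_infty : set (\bar R) :=
  \bigcup_(k : nat) [set k%:R%:E] `|` [set +oo%E].

Let measurable_nat_or_infty : measurable nat_or_infty.
Proof.
apply: measurableU; last exact: emeasurable_set1.
by apply: bigcupT_measurable => k; exact: emeasurable_set1.
Qed.

Lemma nneseries_lt_nat (x : \bar R) : nat_or_infty x ->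
  (\sum_(0 <= k <oo) (k%:R%:E < x)%E%:R%:E)%E = x.
Proof.
move=> [[n _ ->]|->].
  have h m : (\sum_(0 <= k < m) (k%:R%:E < n%:R%:E :> \bar R)%E%:R%:E)%E =
      (minn m n)%:R%:E :> \bar R.
    elim: m => [|m IH]; first by rewrite big_geq// min0n.
    rewrite big_nat_recr//= IH -EFinD -natrD lte_fin ltr_nat; congr (_%:R%:E).
    by case: ltnP; lia.
  apply: lim_near_cst => //.
  by exists n => // m /= nm; rewrite h (minn_idPr nm).
apply/cvg_lim => //.
rewrite (_ : (fun n : nat => _) = (fun n : nat => n%:R%:E)).
  by apply/cvgeryP; exact: cvgr_idn.
apply/funext => m; rewrite (eq_bigr (fun=> 1%:E)); last by move=> k _; rewrite ltry.
by rewrite sumEFin sumr_const_nat subn0.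
Qed.

Context (d : measure_display) (Omega : measurableType d) (P : probability Omega R).

(** Only the law of [T] is prescribed, so its integrality is transferred from the reference
    collector and holds almost everywhere. *)
Lemma coupon_ae_nat_or_infty N (T : {RV P >-> \bar R}) :
  coupon_distributed N T -> \forall w \ae P, nat_or_infty (T w).
Proof.
move=> [d' [W [Q [X [_ law]]]]].
exists (T @^-1` (~` nat_or_infty)); split => //.
- rewrite -[X in measurable X]setTI; apply: measurable_funP => //.
  exact: measurableC.
- transitivity (distribution P T (~` nat_or_infty)) => //.
  rewrite law; last exact: measurableC.
  rewrite (_ : mkset _ = set0) ?measure0//; apply/seteqP; split => // w /=.
  apply: contra_notP => _.
  have [[k ->]| ->] := @collection_time_nat R N (fun n => X n w); last by right.
  by left; exists k.
Qed.

Lemma coupon_tail N (T : {RV P >-> \bar R}) k : (0 < N)%N ->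
  coupon_distributed N T ->
  P (T @^-1` [set x | (k%:R%:E < x)%E]) = (collection_tail R N k)%:E.
Proof.
move=> N0 [d' [W [Q [X [unifX law]]]]].
have mlt : measurable [set x : \bar R | (k%:R%:E < x)%E].
  rewrite -[X in measurable X]setTI.
  by apply: emeasurable_fun_o_infty => //; exact: measurable_id.
rewrite -[LHS]/(distribution P T _) law//.
rewrite (_ : mkset _ = ~` [set w | collected N (fun n => X n w) k]).
  rewrite probability_setC ?(prob_collected N0 unifX)//.
  exact: measurable_collected.
apply/seteqP; split => w /=.
  by rewrite ltNge => /negP; apply: contra_not => /(collection_time_le (R := R)).
by move=> h; rewrite ltNge; apply/negP => /collection_time_le.
Qed.

Lemma measurable_min_time p (T : 'I_p -> {RV P >-> \bar R}) :
  measurable_fun setT (min_time T).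
Proof.
rewrite /min_time; elim: (index_enum _) => [|i s IH].
  by under eq_fun do rewrite big_nil; exact: measurable_cst.
under eq_fun do rewrite big_cons.
exact: measurable_mine.
Qed.

(** The minimum exceeds [k] exactly when every collector does, so independence gives the power [p];
    [nneseries_lt_nat] writes the minimum as a series of indicators, integrated term by term. *)
Lemma expected_min_series N p (T : 'I_p -> {RV P >-> \bar R}) : (0 < N)%N ->
  mutually_independent T -> (forall i, coupon_distributed N (T i)) ->
  expected_min T = (\sum_(0 <= k <oo) (collection_tail R N k ^+ p)%:E)%E.
Proof.
move=> N0 indT lawT.
pose A k := [set w | (k%:R%:E < min_time T w)%E].
have mA k : measurable (A k).
  rewrite -[X in measurable X]setTI.
  by apply: emeasurable_fun_o_infty => //; exact: measurable_min_time.
have PA k : P (A k) = (collection_tail R N k ^+ p)%:E.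
  have -> : A k = \bigcap_(i in [set` enum 'I_p]) T i @^-1` [set x | (k%:R%:E < x)%E].
    apply/seteqP; split => w /=.
      by move=> /bigmin_gtP[_ h] i _; exact: h.
    move=> h; apply/bigmin_gtP; split; rewrite ?ltry// => i _.
    by apply: h; rewrite /= mem_enum.
  rewrite (indT _ (fun=> [set x | (k%:R%:E < x)%E])) ?enum_uniq//; last first.
    move=> _; rewrite -[X in measurable X]setTI.
    by apply: emeasurable_fun_o_infty => //; exact: measurable_id.
  under eq_bigr do rewrite (coupon_tail k N0)//.
  rewrite big_const_seq count_predT -cardE card_ord.
  by elim: p {T indT lawT A mA} => [|q IH]; rewrite ?expr0// iterS IH -EFinM exprS.
rewrite /expected_min.
transitivity (\int[P]_w (\sum_(0 <= k <oo) (\1_(A k) w)%:E)%E)%E.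
  apply: ae_eq_integral => //.
  - exact: measurable_min_time.
  - apply: ge0_emeasurable_sum => // k _.
    by apply/measurable_EFinP; exact: measurable_indic.
  - have : \forall w \ae P, forall i, nat_or_infty (T i w).
      by apply: filter_forall => i; exact: coupon_ae_nat_or_infty (lawT i).
    apply: filterS => w h _.
    have {h} : nat_or_infty (min_time T w).
      apply: (big_ind nat_or_infty) => [|x y hx hy|//]; first by right.
      by rewrite /Order.min; case: ifP.
    move=> /nneseries_lt_nat {1}<-.
    apply: eq_eseriesr => k _; rewrite indicE; congr (_%:R%:E).
    by rewrite /A mem_setE.
rewrite integral_nneseries//; last first.
  by move=> k; apply/measurable_EFinP; exact: measurable_indic.
by apply: eq_eseriesr => k _; rewrite integral_indic// setIT; exact: PA.
Qed.

End ExpectedMin.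

(** * The exact formula and the final assembly *)

Lemma collection_tail_stirling2 (R : realType) (N k : nat) : (0 < N)%N ->
  collection_tail R N k = 1 - (stirling2 k N)%:R * N`!%:R / N%:R ^+ k.
Proof.
move=> N0; rewrite /collection_tail; congr (1 - _).
have := @covering_countE R 'I_N [set: 'I_N]%SET k; rewrite cardsT card_ord => <-//.
by rewrite covering_count_stirling2 natrM.
Qed.

Theorem theorem2p1 (R : realType) (p : nat) (hp : (1 <= p)%N)
  (d : nat -> measure_display) (Omega : forall N : nat, measurableType (d N))
  (P : forall N : nat, probability (Omega N) R)
  (T : forall N : nat, 'I_p -> {RV (P N) >-> \bar R})
  (hind : forall N : nat, (1 <= N)%N -> mutually_independent (T N))
  (hlaw : forall N : nat, (1 <= N)%N ->
     forall i : 'I_p, coupon_distributed N (T N i)) :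
  (forall N : nat, (1 <= N)%N ->
     expected_min (T N) \is a fin_num /\
     expected_min (T N) =
       (\sum_(0 <= k <oo)
          ((1 - (stirling2 k N)%:R * (N`!)%:R / N%:R ^+ k) ^+ p)%:E)%E) /\
  (exists eps : nat -> R,
     (forall N : nat, (1 <= N)%N ->
        fine (expected_min (T N)) =
          N%:R * (ln N%:R + (euler_gamma R + p%:R * min_const R p) + eps N)) /\
     eps =O_\oo (fun N : nat => (ln N%:R) ^+ 2 / N%:R)).
Proof.
have series N : (1 <= N)%N -> expected_min (T N) =
    (\sum_(0 <= k <oo) (collection_tail R N k ^+ p)%:E)%E.
  by move=> N0; exact: expected_min_series N0 (hind N N0) (hlaw N N0).
have cvg_tails N : (1 <= N)%N ->
    cvgn (fun M => \sum_(0 <= k < M) collection_tail R N k ^+ p).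
  move=> N0; apply: nondecreasing_is_cvgn.
    apply/nondecreasing_seqP => M; rewrite big_nat_recr//= lerDl exprn_ge0//.
    by have /andP[] := @collection_tail_itv R N M N0.
  (* This bound, uniform in [M], makes the expectation finite. *)
  exists (N%:R * harmonic_sum R N) => _ [M _ <-].
  exact: sum_collection_tail_exp_le.
have expectedE N : (1 <= N)%N -> expected_min (T N) =
    (limn (fun M => \sum_(0 <= k < M) collection_tail R N k ^+ p))%:E.
  move=> N0; rewrite series// -EFin_lim; last exact: cvg_tails.
  by congr (limn _); apply/funext => M /=; rewrite sumEFin.
split=> [N N0|].
  split; first by rewrite expectedE.
  rewrite series//; apply: eq_eseriesr => k _.
  by rewrite collection_tail_stirling2.
apply: expected_min_asymptotics => // N N0.
by rewrite expectedE//; exact: cvg_tails.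
Qed.
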